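(* Let $(M_i,g_i)$, $i=1,2$, be connected Riemannian manifolds and let $f_1\in C^\infty(M_1)$ be a non-constant positive function. Assume that the gradient of $f_i$ is parallel with respect to $\nabla^i$ for $i=1,2$. Then for any $X_i,Y_i,Z_i\in\Gamma(TM_i)$, $i=1,2$, the curvature tensor $\mathcal R$ of $h_{f_1f_2}$ satisfies $$\mathcal R(X_1^h,Y_1^h)Z_1^h=(\mathcal R^1(X_1,Y_1)Z_1)^h,$$ $$\mathcal R(X_2^v,Y_2^v)Z_2^v=(\mathcal R^2(X_2,Y_2)Z_2)^v-\frac{b_1}{1+(cf_2^v)^2b_1}\big\{(X_2\wedge_{g_2}Y_2)Z_2\big\}^v+\frac{c^2f_1^hf_2^vb_1}{(1+(cf_2^v)^2b_1)^2}\big\{((X_2\wedge_{g_2}Y_2)Z_2)(f_2)\big\}^v(\mathrm{grad} f_1)^h,$$ $$\mathcal R(X_1^h,Y_1^h)Z_2^v=0,$$ $$\mathcal R(X_2^v,Y_2^v)Z_1^h=\frac{c^2f_2^vb_1(Z_1(f_1))^h}{f_1^h(1+(cf_2^v)^2b_1)}\big\{(X_2\wedge_{g_2}Y_2)\mathrm{grad} f_2\big\}^v,$$ $$\mathcal R(X_1^h,Y_2^v)Z_1^h=\frac{c^2X_1(\ln f_1)^hZ_1(\ln f_1)^hY_2(f_2)^v}{1+(cf_2^v)^2b_1}(\mathrm{grad} f_2)^v,$$ $$\mathcal R(X_1^h,Y_2^v)Z_2^v=\frac{c^2X_1(\ln f_1)^h}{1+(cf_2^v)^2b_1}\Big\{f_2^vb_1\big((\mathrm{grad}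 f_2\wedge_{g_2}Y_2)Z_2\big)^v-\frac{f_1^hY_2(f_2)^vZ_2(f_2)^v}{1+(cf_2^v)^2b_1}(\mathrm{grad} f_1)^h\Big\},$$ where $(X_2\wedge_{g_2}Y_2)Z_2=g_2(Y_2,Z_2)X_2-g_2(X_2,Z_2)Y_2$.
   Context: $\pi_i:M_1\times M_2\to M_i$ are the projections; $\varphi_1^h=\varphi_1\circ\pi_1$, $\varphi_2^v=\varphi_2\circ\pi_2$ for functions. The horizontal lift $X_1^h$ of a vector field $X_1$ on $M_1$ is the vector field on $M_1\times M_2$ with $d\pi_1(X_1^h)=X_1\circ\pi_1$, $d\pi_2(X_1^h)=0$; the vertical lift $X_2^v$ of a vector field on $M_2$ is defined symmetrically. $c\in\mathbb R$ is arbitrary, $f_i:M_i\to(0,\infty)$ is smooth, and $$h_{f_1f_2}=\pi_1^*g_1+(f_1^h)^2\pi_2^*g_2+\frac{c^2}{2}(f_2^v)^2\,df_1^h\odot df_1^h,\qquad \alpha\odot\beta=\alpha\otimes\beta+\beta\otimes\alpha,$$ a Riemannian metric on $M_1\times M_2$. $\nabla^i$ and $\mathcal R^i$ are the Levi-Civita connection and curvature tensor of $g_i$; $\nabla$ and $\mathcal R$ those of $h_{f_1f_2}$, with the convention $\mathcal R(X,Y)Z=\nabla_X\nabla_YZ-\nabla_Y\nabla_XZ-\nabla_{[X,Y]}Z$. $\mathrm{grad} f_i$ is the $g_i$-gradient and $b_1=g_1(\mathrm{grad} f_1,\mathrm{grad} f_1)$, which is a constant since $\mathrm{grad} f_1$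 is parallel and $M_1$ is connected. *)

(* Defs.v *)
From HB Require Import structures.
From mathcomp Require Import all_boot all_order all_algebra.
From mathcomp Require Import all_classical all_reals all_analysis.
From mathcomp Require Import ring.
Set Implicit Arguments.
Unset Strict Implicit.
Unset Printing Implicit Defensive.

Import Order.TTheory GRing.Theory Num.Theory numFieldNormedType.Exports.
Local Open Scope classical_set_scope.
Local Open Scope ring_scope.

Section Calculus.
Context {R : realType}.

(* Class C^k on an open set U of R^n, for total functions whose values outside U
   are irrelevant: every x in U has a neighbourhood inside U. *)
Fixpoint Ck n (k : nat) (U : set 'rV[R]_n) (f : 'rV[R]_n -> R)
    : Prop :=
  if k is k'.+1 then
    (forall x, U x -> differentiable f x) /\
    (forall v, Ck k' U (fun x => 'D_v f x))
  else forall x, U x -> {for x, continuous f}.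

Definition smooth_on n (U : set 'rV[R]_n) (f : 'rV[R]_n -> R) : Prop :=
  forall k, Ck k U f.

Lemma CkS n k (U : set 'rV[R]_n) f : Ck k.+1 U f -> Ck k U f.
Proof.
elim: k f => [|k IH] f [df Df].
  by move=> x Ux; exact/differentiable_continuous/df.
by split=> // v; apply: IH.
Qed.

Lemma Ck_sub n k (U V : set 'rV[R]_n) f : V `<=` U -> Ck k U f -> Ck k V f.
Proof.
move=> VU; elim: k f => [|k IH] f /=; first by move=> h x /VU; exact: h.
by move=> [df Df]; split=> [x /VU|v]; [exact: df|exact: IH].
Qed.

Lemma near_eq_differentiable n (f g : 'rV[R]_n -> R) x :
  (\near x, f x = g x) -> differentiable f x -> differentiable g x.
Proof.
move=> fg df; rewrite (_ : g = f + (g - f)); last by rewrite addrC subrK.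
apply: differentiableD => //; pose e := g - f.
have ex : \near x, e x = 0.
  by near=> y; rewrite /e /GRing.add /= /GRing.opp /= (near fg y) ?subrr//.
have h0 : e \o shift x = cst (e x) + (\0 : 'rV[R]_n -> R) +o_ 0 id.
  have ex0 : \forall h \near 0, e (h + x) = 0.
    by move: ex; rewrite (near_shift 0) /= subr0.
  apply/eqaddoP => _/posnumP[eps]; near=> h.
  rewrite /= !fctE /= (nbhs_singleton ex).
  rewrite (_ : e (h + x) = 0); last first.
    by near: h.
  by rewrite ?addr0 ?subr0 normr0 mulr_ge0.
have c0 : continuous (\0 : 'rV[R]_n -> R) by exact: cst_continuous.
have d0 := diff_unique c0 h0.
by apply/diff_locallyP; rewrite d0.
Unshelve. all: by end_near. Qed.

Lemma Ck_ext n k (U : set 'rV[R]_n) f g : open U ->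
  (forall x, U x -> f x = g x) -> Ck k U f -> Ck k U g.
Proof.
move=> oU; elim: k f g => [|k IH] f g fg /=.
  move=> h x Ux; have fgx : \near x, f x = g x.
    by near=> y; apply: fg; near: y; exact: open_nbhs_nbhs.
  have hx : f @ x --> f x by exact: h.
  have -> : {for x, continuous g} = (g @ x --> f x) by rewrite (nbhs_singleton fgx).
  exact: (cvg_trans (near_eq_cvg fgx) hx).
have fgx x : U x -> \near x, f x = g x.
  by move=> Ux; near=> y; apply: fg; near: y; exact: open_nbhs_nbhs.
move=> [df Df]; split=> [x Ux|v].
  exact: near_eq_differentiable (fgx x Ux) (df x Ux).
apply: IH (Df v) => x Ux; exact: near_eq_derive (fgx x Ux).
Unshelve. all: by end_near.
Qed.

Lemma Ck_cst n k (U : set 'rV[R]_n) (a : R) : Ck k U (fun=> a).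
Proof.
elim: k a => [|k IH] a /=; first by move=> x _; exact: cst_continuous.
split=> // v; have -> : 'D_v (fun=> a) = (fun=> 0) :> ('rV[R]_n -> R).
  by apply/funext => x; rewrite derive_cst.
exact: IH.
Qed.

Lemma CkD n k (U : set 'rV[R]_n) f g : open U ->
  Ck k U f -> Ck k U g -> Ck k U (f \+ g).
Proof.
move=> oU; elim: k f g => [|k IH] f g /=.
  by move=> hf hg x Ux; apply: continuousD; [exact: hf|exact: hg].
move=> [df Df] [dg Dg]; split=> [x Ux|v].
  by apply: differentiableD; [exact: df|exact: dg].
apply: Ck_ext (IH _ _ (Df v) (Dg v)) => // x Ux /=.
by rewrite [RHS]deriveD; [|exact/diff_derivable/df|exact/diff_derivable/dg].
Qed.

Lemma CkM n k (U : set 'rV[R]_n) f g : open U ->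
  Ck k U f -> Ck k U g -> Ck k U (f \* g).
Proof.
move=> oU; elim: k f g => [|k IH] f g.
  by move=> hf hg x Ux; apply: continuousM; [exact: hf|exact: hg].
move=> Cf Cg; case: (Cf) (Cg) => [df Df] [dg Dg]; split=> [x Ux|v].
  by apply: differentiableM; [exact: df|exact: dg].
apply: Ck_ext (CkD oU (IH _ _ (CkS Cf) (Dg v)) (IH _ _ (CkS Cg) (Df v))) => //.
move=> x Ux /=.
by rewrite [RHS]deriveM; [|exact/diff_derivable/df|exact/diff_derivable/dg].
Qed.

Lemma CkV n k (U : set 'rV[R]_n) f : open U -> (forall x, U x -> f x != 0) ->
  Ck k U f -> Ck k U (fun x => (f x)^-1).
Proof.
move=> oU f0; elim: k f f0 => [|k IH] f f0.
  by move=> hf x Ux; apply: continuousV; [exact: f0|exact: hf].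
move=> Cf; case: (Cf) => [df Df]; split=> [x Ux|v].
  by apply: differentiableV; [exact: df|exact: f0].
have CV := IH _ f0 (CkS Cf).
apply: Ck_ext (CkM oU (Ck_cst k U (-1)) (CkM oU (CkM oU CV CV) (Df v))) => //.
move=> x Ux /=; rewrite deriveV ?f0 //; last exact/diff_derivable/df.
by rewrite -exprVn mulN1r scaleNr expr2.
Qed.

Lemma Ck_ln n k (U : set 'rV[R]_n) f : open U -> (forall x, U x -> 0 < f x) ->
  Ck k U f -> Ck k U (fun x => ln (f x)).
Proof.
move=> oU f0; case: k => [|k].
  by move=> hf x Ux; apply: continuous_comp; [exact: hf|exact/continuous_ln/f0].
have dln (y : R) : 0 < y -> differentiable (@ln R) y.
  move=> y0; apply/derivable1_diffP.
  exact: (@ex_derive _ _ _ _ _ _ _ (is_derive1_ln y0)).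
move=> Cf; case: (Cf) => [df Df]; split=> [x Ux|v].
  by apply: (@differentiable_comp _ _ _ _ f (@ln R)); [exact: df|exact/dln/f0].
have Ci : Ck k U (fun x => (f x)^-1).
  by apply: CkV (CkS Cf) => // x /f0; case: ltgtP.
apply: Ck_ext (CkM oU (Df v) Ci) => // x Ux /=.
have fx0 := f0 _ Ux.
rewrite [RHS](@deriveE _ _ _ ((@ln R) \o f)); last first.
  by apply: differentiable_comp; [exact: df|exact/dln].
rewrite diff_comp /=; [|exact: df|exact/dln].
rewrite -(deriveE v (df _ Ux)).
have -> : 'd (@ln R) (f x) ('D_v f x) = 'D_v f x *: 'd (@ln R) (f x) 1.
  by rewrite -linearZ /= /GRing.scale /= mulr1.
have [_ ln'] := is_derive1_ln fx0.
by rewrite -ln' -derive1E derive1E' //; exact: dln.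
Qed.

Lemma Ck_comp_linear m n k (L : {linear 'rV[R]_m -> 'rV[R]_n})
    (U : set 'rV[R]_n) (V : set 'rV[R]_m) f : continuous L -> open V ->
  (forall x, V x -> U (L x)) -> Ck k U f -> Ck k V (f \o L).
Proof.
move=> cL oV VU; elim: k f => [|k IH] f.
  move=> hf x Vx; apply: continuous_comp; [exact: cL|exact/hf/VU].
have dL x : differentiable L x by exact: linear_differentiable.
move=> [df Df]; split=> [x Vx|v].
  by apply: differentiable_comp => //; exact/df/VU.
apply: Ck_ext (IH _ (Df (L v))) => // x Vx /=.
have dfx := df _ (VU _ Vx).
have dfL : differentiable (f \o L) x by exact: differentiable_comp.
rewrite (deriveE v dfL) (deriveE (L v) dfx) (diff_comp (dL x) dfx) /=.
by rewrite (diff_lin x cL).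
Qed.

Lemma mx_continuous (T : topologicalType) m n (f : T -> 'M[R]_(m, n)) x :
  (forall i j, {for x, continuous (fun y => f y i j)}) -> {for x, continuous f}.
Proof.
move=> fx A [P fP PA].
suff : \forall y \near x, forall i j, P i j (f y i j).
  by apply: filterS => y Py; exact: PA.
by apply: filter_forall => i; apply: filter_forall => j; exact/fx/fP.
Qed.

Lemma lsubmx_continuous m n : continuous (@lsubmx R 1 m n).
Proof.
move=> x; apply: mx_continuous => i j.
rewrite (_ : (fun _ => _) = fun y : 'rV[R]_(m + n) => y i (lshift n j)).
  exact: coord_continuous.
by apply/funext => y; rewrite mxE.
Qed.

Lemma rsubmx_continuous m n : continuous (@rsubmx R 1 m n).
Proof.
move=> x; apply: mx_continuous => i j.
rewrite (_ : (fun _ => _) = fun y : 'rV[R]_(m + n) => y i (rshift m j)).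
  exact: coord_continuous.
by apply/funext => y; rewrite mxE.
Qed.

End Calculus.

(* cmap and cinv are total functions, mutually inverse homeomorphisms between
   the open sets cdom and ccod; their values elsewhere are irrelevant. *)
Record chart (R : realType) (n : nat) (M : topologicalType) := Chart {
  cdom : set M;
  ccod : set 'rV[R]_n;
  cmap : M -> 'rV[R]_n;
  cinv : 'rV[R]_n -> M;
  cdom_open : open cdom;
  ccod_open : open ccod;
  cmap_cod : forall p, cdom p -> ccod (cmap p);
  cinv_dom : forall x, ccod x -> cdom (cinv x);
  cmapK : forall p, cdom p -> cinv (cmap p) = p;
  cinvK : forall x, ccod x -> cmap (cinv x) = x;
  cmap_continuous : forall p, cdom p -> {for p, continuous cmap};
  cinv_continuous : forall x, ccod x -> {for x, continuous cinv} }.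

Arguments cdom_open {R n M} c.
Arguments ccod_open {R n M} c.

Definition overlap (R : realType) n (M : topologicalType) (a b : chart R n M) :
  set 'rV[R]_n := [set x | ccod a x /\ cdom b (cinv a x)].

(* The atlas need not be maximal: it determines the smooth structure. *)
Record manifold (R : realType) (n : nat) := Manifold {
  mcarrier :> topologicalType;
  atlas : set (chart R n mcarrier);
  manifold_hausdorff : hausdorff_space mcarrier;
  manifold_second_countable : @second_countable mcarrier;
  atlas_cover : forall p, exists2 a, atlas a & cdom a p;
  atlas_smooth : forall a b, atlas a -> atlas b -> forall i,
    smooth_on (overlap a b) (fun x => cmap b (cinv a x) 0 i) }.

Lemma setX_open (T U : topologicalType) (A : set T) (B : set U) :
  open A -> open B -> open (A `*` B).
Proof.
move=> oA oB; rewrite openE => -[x y] [/= Ax By].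
by exists (A, B) => //; split; exact: open_nbhs_nbhs.
Qed.

Arguments atlas {R n} m : rename.
Arguments atlas_cover {R n} m p : rename.
Arguments manifold_second_countable {R n} m : rename.

Section ProductManifold.
Context {R : realType} {m n : nat}.

Section ProductChart.
Context {M N : topologicalType} (a : chart R m M) (b : chart R n N).

Let dom : set (M * N) := cdom a `*` cdom b.
Let cod : set 'rV[R]_(m + n) := [set x | ccod a (lsubmx x) /\ ccod b (rsubmx x)].
Let map (p : M * N) : 'rV[R]_(m + n) := row_mx (cmap a p.1) (cmap b p.2).
Let inv (x : 'rV[R]_(m + n)) : M * N := (cinv a (lsubmx x), cinv b (rsubmx x)).

Let dom_open : open dom.
Proof. by apply: setX_open; exact: cdom_open. Qed.

Let cod_open : open cod.
Proof.
have -> : cod = lsubmx @^-1` ccod a `&` rsubmx @^-1` ccod b by [].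
apply: openI.
  apply: open_comp; last exact: ccod_open.
  by move=> x _; exact: lsubmx_continuous.
apply: open_comp; last exact: ccod_open.
by move=> x _; exact: rsubmx_continuous.
Qed.

Let map_continuous p : dom p -> {for p, continuous map}.
Proof.
move=> [ap bp]; apply: mx_continuous => i j.
case: (split_ordP j) => k ->.
  rewrite (_ : (fun _ => _) = (fun y => cmap a y i k) \o fst); last first.
    by apply/funext => y /=; rewrite row_mxEl.
  apply: continuous_comp; first exact: cvg_fst.
  apply: (@continuous_comp _ _ _ (cmap a) (fun y => y i k)).
    exact: cmap_continuous.
  exact: coord_continuous.
rewrite (_ : (fun _ => _) = (fun y => cmap b y i k) \o snd); last first.
  by apply/funext => y /=; rewrite row_mxEr.
apply: continuous_comp; first exact: cvg_snd.
apply: (@continuous_comp _ _ _ (cmap b) (fun y => y i k)).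
  exact: cmap_continuous.
exact: coord_continuous.
Qed.

Let inv_continuous x : cod x -> {for x, continuous inv}.
Proof.
move=> [ax bx].
have ca : {for x, continuous (cinv a \o lsubmx)}.
  by apply: continuous_comp; [exact: lsubmx_continuous|exact: cinv_continuous].
have cb : {for x, continuous (cinv b \o rsubmx)}.
  by apply: continuous_comp; [exact: rsubmx_continuous|exact: cinv_continuous].
exact: cvg_pair ca cb.
Qed.

Let map_cod p : dom p -> cod (map p).
Proof.
by move=> [ap bp]; rewrite /cod /map /= row_mxKl row_mxKr; split;
  exact: cmap_cod.
Qed.

Let inv_dom x : cod x -> dom (inv x).
Proof. by move=> [ax bx]; split; exact: cinv_dom. Qed.

Let mapK p : dom p -> inv (map p) = p.
Proof.
by case: p => p q [/= ap bq]; rewrite /inv /map /= row_mxKl row_mxKr !cmapK.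
Qed.

Let invK x : cod x -> map (inv x) = x.
Proof. by move=> [ax bx]; rewrite /map /inv /= !cinvK ?hsubmxK. Qed.

Definition prod_chart : chart R (m + n) (M * N)%type :=
  Chart dom_open cod_open map_cod inv_dom mapK invK
        map_continuous inv_continuous.

End ProductChart.

Lemma overlap_open k (T : topologicalType) (a b : chart R k T) :
  open (overlap a b).
Proof.
rewrite openE => x [ax bx]; rewrite /interior.
have H : nbhs x (cinv a @^-1` cdom b).
  exact: (cinv_continuous ax (open_nbhs_nbhs (conj (cdom_open b) bx))).
have K := open_nbhs_nbhs (conj (ccod_open a) ax).
by apply: filterS2 K H => y.
Qed.

Variables (M : manifold R m) (N : manifold R n).

Let prod_hausdorff : hausdorff_space (M * N)%type.
Proof.
have nbhsX (x : M * N) A B : nbhs x.1 A -> nbhs x.2 B -> nbhs x (A `*` B).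
  by move=> xA xB; exists (A, B).
move=> [p1 p2] [q1 q2] pq; congr pair; apply: manifold_hausdorff => A B pA qB.
  have [||[x y] [[/= Ax _] [/= Bx _]]] := pq (A `*` setT) (B `*` setT).
  - by apply: nbhsX => //; exact: filterT.
  - by apply: nbhsX => //; exact: filterT.
  - by exists x.
have [||[x y] [[/= _ Ay] [/= _ By]]] := pq (setT `*` A) (setT `*` B).
- by apply: nbhsX => //; exact: filterT.
- by apply: nbhsX => //; exact: filterT.
- by exists y.
Qed.

Let prod_second_countable : @second_countable (M * N)%type.
Proof.
have [B cB [oB bB]] := manifold_second_countable M.
have [C cC [oC bC]] := manifold_second_countable N.
exists [set X.1 `*` X.2 | X in B `*` C].
  apply: sub_countable (card_image_le _ _) _; exact: countableX.
split=> [_ [[X Y] [/= BX CY] <-]|[p q] A].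
  by apply: setX_open; [exact: oB|exact: oC].
move=> [[X Y] [/= pX qY] XYA].
have [X' [BX' X'p] X'X] := bB p X pX.
have [Y' [CY' Y'q] Y'Y] := bC q Y qY.
exists (X' `*` Y'); first by split=> //; exists (X', Y').
by move=> [x y] [/= X'x Y'y]; apply: XYA; split; [exact: X'X|exact: Y'Y].
Qed.

Let prod_atlas : set (chart R (m + n) (M * N)%type) :=
  [set c | exists a b, [/\ atlas M a, atlas N b & c = prod_chart a b]].

Let prod_cover p : exists2 c, prod_atlas c & cdom c p.
Proof.
have [a Aa ap] := atlas_cover M p.1; have [b Ab bp] := atlas_cover N p.2.
by exists (prod_chart a b) => //; exists a, b.
Qed.

Let prod_smooth c d : prod_atlas c -> prod_atlas d -> forall i,
  smooth_on (overlap c d) (fun x => cmap d (cinv c x) 0 i).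
Proof.
move=> [a [b [Aa Ab ->]]] [a' [b' [Aa' Ab' ->]]] i k.
have oV : open (overlap (prod_chart a b) (prod_chart a' b')).
  exact: overlap_open.
case: (split_ordP i) => j ->.
  rewrite (_ : (fun _ => _) = (fun x => cmap a' (cinv a x) 0 j) \o lsubmx).
    apply: Ck_comp_linear oV _ (atlas_smooth Aa Aa' j k).
      exact: lsubmx_continuous.
    by move=> x [[ax bx] [/= a'x b'x]].
  by apply/funext => x /=; rewrite row_mxEl.
rewrite (_ : (fun _ => _) = (fun x => cmap b' (cinv b x) 0 j) \o rsubmx).
  apply: Ck_comp_linear oV _ (atlas_smooth Ab Ab' j k).
    exact: rsubmx_continuous.
  by move=> x [[ax bx] [/= a'x b'x]].
by apply/funext => x /=; rewrite row_mxEr.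
Qed.

Definition prod_manifold : manifold R (m + n) :=
  Manifold prod_hausdorff prod_second_countable prod_cover prod_smooth.

End ProductManifold.

Section SmoothFunctions.
Context {R : realType} {n : nat} (M : manifold R n).

Definition is_smooth (f : M -> R) : Prop :=
  forall a, atlas M a -> smooth_on (ccod a) (f \o cinv a).

Definition smooth_pred : {pred M -> R} := fun f => `[< is_smooth f >].

Record smooth_fun := SmoothFun {
  smooth_val :> M -> R;
  smooth_valP : smooth_val \in smooth_pred }.

HB.instance Definition _ := [isSub for smooth_val].
HB.instance Definition _ := [Choice of smooth_fun by <:].

Fact smooth_subring : subring_closed smooth_pred.
Proof.
split=> [|f g /asboolP fS /asboolP gS|f g /asboolP fS /asboolP gS].
- by apply/asboolP => a Aa k; exact: Ck_cst.
- apply/asboolP => a Aa k.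
  rewrite (_ : _ \o _ = (f \o cinv a) \+ ((fun=> -1) \* (g \o cinv a))).
    apply: CkD (fS a Aa k) _; first exact: ccod_open.
    by apply: CkM (Ck_cst _ _ _) (gS a Aa k); exact: ccod_open.
  by apply/funext => x /=; rewrite mulN1r.
- by apply/asboolP => a Aa k; apply: CkM (fS a Aa k) (gS a Aa k);
    exact: ccod_open.
Qed.

Fact smooth_submod : submod_closed smooth_pred.
Proof.
split=> [|c f g /asboolP fS /asboolP gS].
  by apply/asboolP => a Aa k; exact: Ck_cst.
apply/asboolP => a Aa k.
apply: (CkD (f := (fun=> c) \* (f \o cinv a)) _ _ (gS a Aa k)).
  exact: ccod_open.
by apply: CkM (Ck_cst _ _ _) (fS a Aa k); exact: ccod_open.
Qed.

HB.instance Definition _ :=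
  GRing.isSubringClosed.Build (M -> R) smooth_pred smooth_subring.
HB.instance Definition _ :=
  GRing.isSubmodClosed.Build R (M -> R) smooth_pred smooth_submod.
HB.instance Definition _ :=
  GRing.SubChoice_isSubComPzRing.Build (M -> R) smooth_pred smooth_fun
    smooth_subring.
HB.instance Definition _ := [SubZmodule_isSubLmodule of smooth_fun by <:].

Lemma smooth_funE (f : smooth_fun) : is_smooth f.
Proof. exact/asboolP/smooth_valP. Qed.

Lemma smooth_fun_ext (f g : smooth_fun) : (forall p, f p = g p) -> f = g.
Proof. by move=> fg; apply/val_inj/funext. Qed.

Definition mk_smooth (f : M -> R) (fS : is_smooth f) : smooth_fun :=
  SmoothFun (asboolT fS).

Fact smooth_ln_subproof (f : smooth_fun) : (forall p, 0 < f p) ->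
  is_smooth (fun p => ln (f p)).
Proof.
move=> f_gt0 a Aa k; apply: Ck_ln (ccod_open a) _ (smooth_funE f Aa k).
by move=> x _; exact: f_gt0.
Qed.
Definition smooth_ln (f : smooth_fun) (f_gt0 : forall p, 0 < f p) : smooth_fun :=
  mk_smooth (smooth_ln_subproof f_gt0).

End SmoothFunctions.

Section TangentVectors.
Context {R : realType} {n : nat} (M : manifold R n).

Definition is_derivation (p : M) (v : smooth_fun M -> R) : Prop :=
  (forall a f g, v (a *: f + g) = a * v f + v g) /\
  (forall f g, v (f * g) = v f * g p + f p * v g).

Definition derivation_pred (p : M) : {pred smooth_fun M -> R} :=
  fun v => `[< is_derivation p v >].

Record tangent (p : M) := Tangent {
  tangent_val :> smooth_fun M -> R;
  tangent_valP : tangent_val \in derivation_pred p }.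

HB.instance Definition _ p := [isSub for @tangent_val p].
HB.instance Definition _ p := [Choice of tangent p by <:].

Fact derivation_submod p : submod_closed (derivation_pred p).
Proof.
split=> [|c u v /asboolP[uL uM] /asboolP[vL vM]]; apply/asboolP.
  have -> : (0 : smooth_fun M -> R) = (fun=> 0) by [].
  by split=> [a f g|f g] /=; rewrite ?mulr0 ?mul0r addr0.
have E w : (c *: u + v) w = c * u w + v w by [].
by split=> [a f g|f g]; rewrite !E ?uL ?vL ?uM ?vM; ring.
Qed.

HB.instance Definition _ p := GRing.isSubmodClosed.Build R (smooth_fun M -> R)
  (derivation_pred p) (derivation_submod p).
HB.instance Definition _ p := [SubChoice_isSubLmodule of tangent p by <:].

(* A smooth section of the tangent bundle; Gamma(TM) is made below a module over
   the ring of smooth functions. *)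
Record vfield := VField {
  vf_at :> forall p, tangent p;
  vf_smooth : forall f, is_smooth (fun p => vf_at p f) }.

HB.instance Definition _ := gen_eqMixin vfield.
HB.instance Definition _ := gen_choiceMixin vfield.

Lemma tangent_ext p (u v : tangent p) : (forall f, u f = v f) -> u = v.
Proof. by move=> uv; apply/val_inj/funext. Qed.

Lemma vfield_ext (X Y : vfield) : (forall p, X p = Y p) -> X = Y.
Proof.
case: X Y => [X sX] [Y sY] /= XY.
have E : X = Y by exact: functional_extensionality_dep.
by case: Y / E sY {XY} => sY; congr VField; exact: Prop_irrelevance.
Qed.

Definition vact (X : vfield) (f : smooth_fun M) : smooth_fun M :=
  mk_smooth (vf_smooth X f).

Fact vf0_smooth f : is_smooth (fun p => (0 : tangent p) f).
Proof. exact: (smooth_funE 0). Qed.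
Definition vf0 := VField vf0_smooth.

Fact vfD_smooth (X Y : vfield) f : is_smooth (fun p => (X p + Y p) f).
Proof. exact: (smooth_funE (vact X f + vact Y f)). Qed.
Definition vfD X Y := VField (vfD_smooth X Y).

Fact vfN_smooth (X : vfield) f : is_smooth (fun p => (- X p) f).
Proof. exact: (smooth_funE (- vact X f)). Qed.
Definition vfN X := VField (vfN_smooth X).

Fact vfZ_smooth (a : smooth_fun M) (X : vfield) f :
  is_smooth (fun p => (a p *: X p) f).
Proof. exact: (smooth_funE (a * vact X f)). Qed.
Definition vfZ a X := VField (vfZ_smooth a X).

Fact vfDA : associative vfD.
Proof. by move=> X Y Z; apply: vfield_ext => p /=; rewrite addrA. Qed.
Fact vfDC : commutative vfD.
Proof. by move=> X Y; apply: vfield_ext => p /=; rewrite addrC. Qed.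
Fact vf0D : left_id vf0 vfD.
Proof. by move=> X; apply: vfield_ext => p /=; rewrite add0r. Qed.
Fact vfND : left_inverse vf0 vfN vfD.
Proof. by move=> X; apply: vfield_ext => p /=; rewrite addNr. Qed.

HB.instance Definition _ := GRing.isZmodule.Build vfield vfDA vfDC vf0D vfND.

Fact vfZA (a b : smooth_fun M) (X : vfield) : vfZ a (vfZ b X) = vfZ (a * b) X.
Proof. by apply: vfield_ext => p /=; rewrite scalerA. Qed.
Fact vf1Z : left_id 1 vfZ.
Proof. by move=> X; apply: vfield_ext => p /=; rewrite scale1r. Qed.
Fact vfZDr : right_distributive vfZ +%R.
Proof. by move=> a X Y; apply: vfield_ext => p /=; rewrite scalerDr. Qed.
Fact vfZDl X : {morph vfZ^~ X : a b / a + b}.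
Proof. by move=> a b; apply: vfield_ext => p /=; rewrite scalerDl. Qed.

HB.instance Definition _ :=
  GRing.Zmodule_isLmodule.Build (smooth_fun M) vfield vfZA vf1Z vfZDr vfZDl.

Fact lie_derivation (X Y : vfield) p :
  (fun f => X p (vact Y f) - Y p (vact X f)) \in derivation_pred p.
Proof.
have vL Z a f g : vact Z (a *: f + g) = a *: vact Z f + vact Z g.
  apply: smooth_fun_ext => q /=.
  by have /asboolP[-> _] := tangent_valP (Z q).
have vM Z f g : vact Z (f * g) = vact Z f * g + f * vact Z g.
  apply: smooth_fun_ext => q /=.
  by have /asboolP[_ ->] := tangent_valP (Z q).
have /asboolP[XL XM] := tangent_valP (X p).
have /asboolP[YL YM] := tangent_valP (Y p).
have XD f g : X p (f + g) = X p f + X p g.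
  by have := XL 1 f g; rewrite scale1r mul1r.
have YD f g : Y p (f + g) = Y p f + Y p g.
  by have := YL 1 f g; rewrite scale1r mul1r.
apply/asboolP; split=> [a f g|f g]; rewrite !(vL, vM).
  by rewrite XL YL; ring.
by rewrite XD YD !XM !YM /=; ring.
Qed.

Fact lie_smooth (X Y : vfield) f :
  is_smooth (fun p => Tangent (lie_derivation X Y p) f).
Proof. exact: (smooth_funE (vact X (vact Y f) - vact Y (vact X f))). Qed.

Definition lie (X Y : vfield) : vfield := VField (lie_smooth X Y).

End TangentVectors.

Section RiemannianGeometry.
Context {R : realType} {n : nat} (M : manifold R n).

Record metric := Metric {
  metric_at :> forall p : M, tangent p -> tangent p -> R;
  metric_sym : forall p (u v : tangent p), metric_at u v = metric_at v u;
  metric_linear : forall p a (u v w : tangent p),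
    metric_at (a *: u + v) w = a * metric_at u w + metric_at v w;
  metric_pos : forall p (v : tangent p), v <> 0 -> 0 < metric_at v v;
  metric_smooth : forall X Y : vfield M,
    is_smooth (fun p => metric_at (X p) (Y p)) }.

Definition inner (g : metric) (X Y : vfield M) : smooth_fun M :=
  mk_smooth (metric_smooth g X Y).

(* R-linearity in the second argument follows from nablaD and nabla_leibniz at a
   constant f. *)
Record connection := Connection {
  nabla :> vfield M -> vfield M -> vfield M;
  nabla_linear : forall f X X' Y,
    nabla (f *: X + X') Y = f *: nabla X Y + nabla X' Y;
  nablaD : forall X Y Y', nabla X (Y + Y') = nabla X Y + nabla X Y';
  nabla_leibniz : forall X f Y,
    nabla X (f *: Y) = vact X f *: Y + f *: nabla X Y }.

Definition levi_civita (g : metric) (D : connection) : Prop :=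
  (forall X Y, D X Y - D Y X = lie X Y) /\
  (forall X Y Z,
     vact X (inner g Y Z) = inner g (D X Y) Z + inner g Y (D X Z)).

Definition curvature (D : connection) (X Y Z : vfield M) : vfield M :=
  D X (D Y Z) - D Y (D X Z) - D (lie X Y) Z.

Definition is_gradient (g : metric) (f : smooth_fun M) (G : vfield M) : Prop :=
  forall p (v : tangent p), g p (G p) v = v f.

Definition parallel (D : connection) (Y : vfield M) : Prop :=
  forall X, D X Y = 0.

Definition wedge (g : metric) (X Y Z : vfield M) : vfield M :=
  inner g Y Z *: X - inner g X Z *: Y.

Definition differential (f : smooth_fun M) (p : M) (v : tangent p) : R := v f.

Definition odot (p : M) (alpha beta : tangent p -> R) (u v : tangent p) : R :=
  alpha u * beta v + beta u * alpha v.

End RiemannianGeometry.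

Section Product.
Context {R : realType} {m n : nat} (M : manifold R m) (N : manifold R n).
Local Notation MN := (prod_manifold M N).

(* f^h and f^v are hfun f and vfun f. *)
Fact hfun_smooth (f : smooth_fun M) : @is_smooth _ _ MN (fun x => f x.1).
Proof.
move=> _ [a [b [Aa Ab ->]]] k.
apply: Ck_comp_linear (ccod_open _) _ (smooth_funE f Aa k).
  exact: lsubmx_continuous.
by move=> x [].
Qed.
Definition hfun (f : smooth_fun M) : smooth_fun MN := mk_smooth (hfun_smooth f).

Fact vfun_smooth (f : smooth_fun N) : @is_smooth _ _ MN (fun x => f x.2).
Proof.
move=> _ [a [b [Aa Ab ->]]] k.
apply: Ck_comp_linear (ccod_open _) _ (smooth_funE f Ab k).
  exact: rsubmx_continuous.
by move=> x [].
Qed.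
Definition vfun (f : smooth_fun N) : smooth_fun MN := mk_smooth (vfun_smooth f).

Fact dpi1_derivation (x : MN) (v : tangent x) :
  (fun f => v (hfun f)) \in derivation_pred (x.1 : M).
Proof.
have /asboolP[vL vM] := tangent_valP v; apply/asboolP; split.
  by move=> a f g; rewrite -vL; congr (v _); exact: smooth_fun_ext.
move=> f g; rewrite -[f x.1]/(hfun f x) -[g x.1]/(hfun g x) -vM.
by congr (v _); exact: smooth_fun_ext.
Qed.
Definition dpi1 (x : MN) (v : tangent x) : tangent (x.1 : M) :=
  Tangent (dpi1_derivation v).

Fact dpi2_derivation (x : MN) (v : tangent x) :
  (fun f => v (vfun f)) \in derivation_pred (x.2 : N).
Proof.
have /asboolP[vL vM] := tangent_valP v; apply/asboolP; split.
  by move=> a f g; rewrite -vL; congr (v _); exact: smooth_fun_ext.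
move=> f g; rewrite -[f x.2]/(vfun f x) -[g x.2]/(vfun g x) -vM.
by congr (v _); exact: smooth_fun_ext.
Qed.
Definition dpi2 (x : MN) (v : tangent x) : tangent (x.2 : N) :=
  Tangent (dpi2_derivation v).

(* The lift operators are specified by d pi_i; a tangent vector of the product is
   determined by its two projections, so each property holds for exactly one
   operator. *)
Definition horizontal_lift (hl : vfield M -> vfield MN) : Prop :=
  forall X x, dpi1 (hl X x) = X x.1 /\ dpi2 (hl X x) = 0.

Definition vertical_lift (vl : vfield N -> vfield MN) : Prop :=
  forall X x, dpi1 (vl X x) = 0 /\ dpi2 (vl X x) = X x.2.

(* pi_1^* g1 + (f1^h)^2 pi_2^* g2 + c^2/2 (f2^v)^2 df1^h (.) df1^h, where odot has no
   factor 1/2, so that the last term is c^2 (f2^v)^2 (df1^h)^2. *)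
Definition h_form (c : R) (f1 : smooth_fun M) (f2 : smooth_fun N)
    (g1 : metric M) (g2 : metric N) (x : MN) (u v : tangent x) : R :=
  g1 x.1 (dpi1 u) (dpi1 v)
  + hfun f1 x ^+ 2 * g2 x.2 (dpi2 u) (dpi2 v)
  + c ^+ 2 / 2 * vfun f2 x ^+ 2 *
    odot (@differential _ _ MN (hfun f1) x)
         (@differential _ _ MN (hfun f1) x) u v.

End Product.

(* Main.v *)
(* Pairing a vector field W on M1 x M2 with its own value at a point only involves
   lifts: fixing one coordinate turns the two components of W into vector fields on
   the factors, and W agrees at that point with the sum of their lifts. Hence
   Koszul's formula on lifts alone determines nabla:
     nabla_{X^h} Y^h = (nabla^1_X Y)^h
       - c^2 f2 X(f1) Y(f1) / f1^2 (grad f2)^v,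
     nabla_{X^h} U^v = nabla_{U^v} X^h
       = c^2 f2 U(f2) X(f1) / E (grad f1)^h + X(f1) / f1 U^v,
     nabla_{U^v} V^v = (nabla^2_U V)^v - f1 g2(U, V) / E (grad f1)^h,
   with E = 1 + (c f2)^2 b1. The curvature formulas follow by expansion, using that
   b1 is constant and that X(Y(f_i)) = (nabla^i_X Y)(f_i) because grad f_i is
   parallel. *)
From HB Require Import structures.
Require Import Defs.
From mathcomp Require Import all_boot all_order all_algebra.
From mathcomp Require Import all_classical all_reals all_analysis.
From mathcomp Require Import ring.
Import Order.TTheory GRing.Theory Num.Theory numFieldNormedType.Exports.
Set Implicit Arguments.
Unset Strict Implicit.
Unset Printing Implicit Defensive.
Local Open Scope classical_set_scope.
Local Open Scope ring_scope.

(** * Smoothness of slices of a product *)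

Section Smooth.
Context {R : realType}.

(** The inclusion of a slice is affine in charts, while [Ck_comp_linear] treats linear maps.
    Directional derivatives commute with translations, so the induction on [k] goes through. *)
Lemma Ck_shift n k (y : 'rV[R]_n) (U : set 'rV[R]_n) f :
  Ck k U f -> Ck k (shift y @^-1` U) (f \o shift y).
Proof.
have cS : continuous (shift y).
  by move=> x; exact: (cvgD cvg_id (@cvg_cst _ y _ _ _)).
elim: k f => [|k IH] f.
  by move=> hf x Ux; apply: continuous_comp; [exact: cS|exact: hf].
move=> [df Df]; split=> [x Ux|v].
  apply: differentiable_comp; last exact: df.
  by rewrite (_ : shift y = id + cst y) //; apply: differentiableD.
have -> : (fun x => 'D_v (f \o shift y) x) = (fun x => 'D_v f x) \o shift y.
  apply/funext => x; rewrite /derive.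
  suff -> : (f \o shift y) \o shift x = f \o shift (shift y x) by [].
  by apply/funext => z /=; rewrite addrA.
exact: IH (Df v).
Qed.

Definition row_mx0 m n (x : 'rV[R]_m) : 'rV[R]_(m + n) := row_mx x 0.
Definition row_0mx m n (x : 'rV[R]_n) : 'rV[R]_(m + n) := row_mx 0 x.

Fact row_mx0_is_linear m n : linear (@row_mx0 m n).
Proof.
by move=> a u v; rewrite /row_mx0 scale_row_mx add_row_mx scaler0 addr0.
Qed.

Fact row_0mx_is_linear m n : linear (@row_0mx m n).
Proof.
by move=> a u v; rewrite /row_0mx scale_row_mx add_row_mx scaler0 addr0.
Qed.

HB.instance Definition _ m n :=
  GRing.isLinear.Build R 'rV[R]_m 'rV[R]_(m + n) _ (@row_mx0 m n)
    (@row_mx0_is_linear m n).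
HB.instance Definition _ m n :=
  GRing.isLinear.Build R 'rV[R]_n 'rV[R]_(m + n) _ (@row_0mx m n)
    (@row_0mx_is_linear m n).

Lemma row_mx_continuous (T : topologicalType) m n (f : T -> 'rV[R]_m)
    (g : T -> 'rV[R]_n) :
  continuous f -> continuous g -> continuous (fun x => row_mx (f x) (g x)).
Proof.
move=> cf cg x; apply: mx_continuous => i j; case: (split_ordP j) => l ->.
  rewrite (_ : (fun _ => _) = (fun y => y i l) \o f); last first.
    by apply/funext => y /=; rewrite row_mxEl.
  by apply: (@continuous_comp _ _ _ f (fun y => y i l));
    [exact: cf|exact: coord_continuous].
rewrite (_ : (fun _ => _) = (fun y => y i l) \o g); last first.
  by apply/funext => y /=; rewrite row_mxEr.
by apply: (@continuous_comp _ _ _ g (fun y => y i l));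
  [exact: cg|exact: coord_continuous].
Qed.

Context {m n : nat} (M : manifold R m) (N : manifold R n).
Local Notation MN := (prod_manifold M N).

(** In charts the inclusion of M1 at height [q] is the linear map [row_mx0] followed by the
    translation by the coordinates of [q]. *)
Lemma slice1_smooth (F : smooth_fun MN) (q : N) : is_smooth (fun p : M => F (p, q)).
Proof.
move=> a Aa k; have [b Ab bq] := atlas_cover N q.
have Ac : atlas MN (prod_chart a b) by exists a, b.
have CF := Ck_shift (row_mx 0 (cmap b q)) (smooth_funE F Ac k).
have E x : row_mx x 0 + row_mx 0 (cmap b q) = row_mx x (cmap b q) :> 'rV[R]_(m + n).
  by rewrite add_row_mx addr0 add0r.
pose L : {linear 'rV[R]_m -> 'rV[R]_(m + n)} := @row_mx0 m n.
have cL : continuous L.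
  by apply: (@row_mx_continuous _ _ _ id (cst 0)) => x;
    [exact: cvg_id|exact: cst_continuous].
have VU x : ccod a x ->
    (shift (row_mx 0 (cmap b q)) @^-1` ccod (prod_chart a b)) (L x).
  move=> ax; rewrite /= /row_mx0 /row_0mx E row_mxKl row_mxKr; split=> //.
  exact: cmap_cod.
have := Ck_comp_linear cL (ccod_open a) VU CF.
apply: Ck_ext (ccod_open a) _ => x ax /=.
by rewrite /row_mx0 /row_0mx E row_mxKl row_mxKr cmapK.
Qed.

Lemma slice2_smooth (F : smooth_fun MN) (p : M) : is_smooth (fun q : N => F (p, q)).
Proof.
move=> b Ab k; have [a Aa ap] := atlas_cover M p.
have Ac : atlas MN (prod_chart a b) by exists a, b.
have CF := Ck_shift (row_mx (cmap a p) 0) (smooth_funE F Ac k).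
have E x : row_mx 0 x + row_mx (cmap a p) 0 = row_mx (cmap a p) x :> 'rV[R]_(m + n).
  by rewrite add_row_mx addr0 add0r.
pose L : {linear 'rV[R]_n -> 'rV[R]_(m + n)} := @row_0mx m n.
have cL : continuous L.
  by apply: (@row_mx_continuous _ _ _ (cst 0) id) => x;
    [exact: cst_continuous|exact: cvg_id].
have VU x : ccod b x ->
    (shift (row_mx (cmap a p) 0) @^-1` ccod (prod_chart a b)) (L x).
  move=> bx; rewrite /= /row_mx0 /row_0mx E row_mxKl row_mxKr; split=> //.
  exact: cmap_cod.
have := Ck_comp_linear cL (ccod_open b) VU CF.
apply: Ck_ext (ccod_open b) _ => x ax /=.
by rewrite /row_mx0 /row_0mx E row_mxKl row_mxKr cmapK.
Qed.

Definition vf_slice1 (W : vfield MN) (q : N) : vfield M :=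
  @VField _ _ M (fun p => dpi1 (W (p, q)))
    (fun f => slice1_smooth (vact W (hfun N f)) q).

Definition vf_slice2 (W : vfield MN) (p : M) : vfield N :=
  @VField _ _ N (fun q => dpi2 (W (p, q)))
    (fun f => slice2_smooth (vact W (vfun M f)) p).

End Smooth.

(** * Algebra of derivations and connections *)

Section Calculus.
Context {R : realType} {n : nat} {M : manifold R n}.
Implicit Types (X Y Z : vfield M) (f g : smooth_fun M).

Lemma smooth_inv_subproof f : (forall p, f p != 0) -> is_smooth (fun p => (f p)^-1).
Proof.
move=> f0 a Aa k; apply: (CkV (ccod_open a)) (smooth_funE f Aa k).
by move=> x _; exact: f0.
Qed.

Definition smooth_inv f (f0 : forall p, f p != 0) : smooth_fun M :=
  mk_smooth (smooth_inv_subproof f0).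

Definition smooth_cst (a : R) : smooth_fun M := a *: (1 : smooth_fun M).

Lemma smooth_cstE a p : smooth_cst a p = a.
Proof. exact: mulr1. Qed.

Lemma smoothD f g p : (f + g) p = f p + g p. Proof. by []. Qed.
Lemma smoothN f p : (- f) p = - f p. Proof. by []. Qed.
Lemma smoothM f g p : (f * g) p = f p * g p. Proof. by []. Qed.
Lemma smooth0 p : (0 : smooth_fun M) p = 0. Proof. by []. Qed.
Lemma smooth1 p : (1 : smooth_fun M) p = 1. Proof. by []. Qed.
Lemma smooth_invE f (f0 : forall p, f p != 0) p : smooth_inv f0 p = (f p)^-1.
Proof. by []. Qed.

Definition smoothE :=
  (smoothD, smoothN, smoothM, smooth0, smooth1, smooth_cstE, smooth_invE).

Lemma vact_scale_add X a f g : vact X (a *: f + g) = a *: vact X f + vact X g.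
Proof.
by apply: smooth_fun_ext => q /=; have /asboolP[-> _] := tangent_valP (X q).
Qed.

Lemma vactM X f g : vact X (f * g) = vact X f * g + f * vact X g.
Proof.
by apply: smooth_fun_ext => q /=; have /asboolP[_ ->] := tangent_valP (X q).
Qed.

Lemma vactD X f g : vact X (f + g) = vact X f + vact X g.
Proof. by have := vact_scale_add X 1 f g; rewrite !scale1r. Qed.

Lemma vact0 X : vact X 0 = 0.
Proof. by apply: (addIr (vact X 0)); rewrite -vactD !add0r. Qed.

Lemma vactN X f : vact X (- f) = - vact X f.
Proof. by apply: (addIr (vact X f)); rewrite -vactD !addNr vact0. Qed.

Lemma vact1 X : vact X 1 = 0.
Proof.
by apply: (addIr (vact X 1)); rewrite add0r -{3}[1]mulr1 vactM mulr1 mul1r.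
Qed.

Lemma vact_cst X a : vact X (smooth_cst a) = 0.
Proof.
rewrite /smooth_cst -[a *: (1 : smooth_fun M)]addr0 vact_scale_add vact1.
by rewrite scaler0 vact0 addr0.
Qed.

(** The product rule applied to [f * smooth_inv f0 = 1], solved after multiplying by [f p]. *)
Lemma vact_inv X f (f0 : forall p, f p != 0) : vact X (@smooth_inv f f0) =
  - (smooth_inv f0 * smooth_inv f0 * vact X f).
Proof.
have fK : f * smooth_inv f0 = smooth_cst 1.
  by apply: smooth_fun_ext => q; rewrite !smoothE divff.
apply: smooth_fun_ext => p; have fp := f0 p; apply: (mulfI fp).
have /eqP := congr1 (fun u => vact X u p) fK.
rewrite vactM vact_cst !smoothE addrC addr_eq0 => /eqP ->.
by field.
Qed.

Lemma vact_lie X Y f : vact (lie X Y) f = vact X (vact Y f) - vact Y (vact X f).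
Proof. exact: smooth_fun_ext. Qed.

Definition vactE := (vactM, vactD, vactN, vact_cst, vact_inv, vact0, vact1).

Lemma vact_addl X Y f : vact (X + Y) f = vact X f + vact Y f.
Proof. exact: smooth_fun_ext. Qed.

Lemma vact_oppl X f : vact (- X) f = - vact X f.
Proof. exact: smooth_fun_ext. Qed.

Lemma vact_zerol f : vact 0 f = 0.
Proof. exact: smooth_fun_ext. Qed.

Lemma vact_scalel g X f : vact (g *: X) f = g * vact X f.
Proof. exact: smooth_fun_ext. Qed.

Definition vact_linearl := (vact_addl, vact_oppl, vact_scalel, vact_zerol).

Section Connection.
Context (D : connection M).

Lemma nabla_addl X Y Z : D (X + Y) Z = D X Z + D Y Z.
Proof. by rewrite -[X]scale1r nabla_linear !scale1r. Qed.

Lemma nabla0l Z : D 0 Z = 0.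
Proof. by apply: (addIr (D 0 Z)); rewrite -nabla_addl !add0r. Qed.

Lemma nabla0r X : D X 0 = 0.
Proof. by apply: (addIr (D X 0)); rewrite -nablaD !add0r. Qed.

Lemma nablaN X Y : D X (- Y) = - D X Y.
Proof. by apply: (addIr (D X Y)); rewrite -nablaD !addNr nabla0r. Qed.

End Connection.

(** * Koszul's formula and parallel gradients *)

Section Metric.
Context (g : metric M).

Lemma inner_sym X Y : inner g X Y = inner g Y X.
Proof. by apply: smooth_fun_ext => p; exact: Defs.metric_sym. Qed.

Lemma inner_addl X Y Z : inner g (X + Y) Z = inner g X Z + inner g Y Z.
Proof.
apply: smooth_fun_ext => p; have := metric_linear g 1 (X p) (Y p) (Z p).
by rewrite scale1r mul1r.
Qed.

Lemma inner0l Z : inner g 0 Z = 0.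
Proof. by apply: (addIr (inner g 0 Z)); rewrite -inner_addl !add0r. Qed.

Lemma inner_scalel f X Z : inner g (f *: X) Z = f * inner g X Z.
Proof.
apply: smooth_fun_ext => p; have := metric_linear g (f p) (X p) 0 (Z p).
have := congr1 (fun u : smooth_fun M => u p) (inner0l Z).
by rewrite /= => -> ; rewrite !addr0.
Qed.

Lemma innerNl X Z : inner g (- X) Z = - inner g X Z.
Proof. by apply: (addIr (inner g X Z)); rewrite -inner_addl !addNr inner0l. Qed.

Lemma inner_addr X Y Z : inner g Z (X + Y) = inner g Z X + inner g Z Y.
Proof. by rewrite inner_sym inner_addl !(inner_sym Z). Qed.

Lemma inner_gradient f G X : is_gradient g f G -> inner g G X = vact X f.
Proof. by move=> gG; apply: smooth_fun_ext => p; exact: gG. Qed.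

Lemma metric_eq0 p (v : tangent p) : g p v v = 0 -> v = 0.
Proof.
by move=> gv; apply: contrapT => /(metric_pos g); rewrite gv ltxx.
Qed.

Context (D : connection M) (D_LC : levi_civita g D).

(** Torsion-freeness turns each bracket, and compatibility each derivative of the metric, into
    covariant derivatives; all but two equal terms cancel. *)
Lemma koszul X Y Z p :
  2 * inner g (D X Y) Z p =
    vact X (inner g Y Z) p + vact Y (inner g X Z) p - vact Z (inner g X Y) p
    + inner g (lie X Y) Z p - inner g (lie X Z) Y p - inner g (lie Y Z) X p.
Proof.
have [T C] := D_LC.
rewrite -!T !C !inner_addl !innerNl (inner_sym (D X Y) Z) (inner_sym (D Y X) Z).
rewrite (inner_sym (D X Z) Y) (inner_sym (D Y Z) X) (inner_sym (D Z X) Y).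
rewrite (inner_sym (D Z Y) X) !smoothE.
ring.
Qed.

Context (f : smooth_fun M) (G : vfield M).
Context (gG : is_gradient g f G) (DG : parallel D G).

(** The Hessian of [f] vanishes: in the derivative of [g G Y] along [X] the term with [D X G] is
    zero. *)
Lemma vact_nabla_parallel X Y : vact (D X Y) f = vact X (vact Y f).
Proof.
have [_ C] := D_LC.
by rewrite -!(inner_gradient _ gG) C DG inner0l add0r.
Qed.

(** The constancy of b1 enters the computations in this infinitesimal form. *)
Lemma vact_norm_parallel X : vact X (inner g G G) = 0.
Proof. by have [_ ->] := D_LC; rewrite DG inner0l inner_sym inner0l addr0. Qed.

End Metric.
End Calculus.

(** * The entire function (exp t - 1) / t and its derivatives *)

Section ExpQuotient.
Context {R : realType}.

(* expq k t is the integral of s ^+ k * expR (s * t) over s in [0, 1], so that expq k.+1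
   is the derivative of expq k. *)
Definition expq_coeff (k n : nat) : R := (n`!%:R * (n + k).+1%:R)^-1.

Definition expq (k : nat) (t : R) : R := limn (pseries (expq_coeff k) t).

Lemma expq_coeff_ge0 k n : 0 <= expq_coeff k n.
Proof. by rewrite invr_ge0 mulr_ge0. Qed.

Lemma expq_coeff_le k n : expq_coeff k n <= (n`!%:R)^-1.
Proof.
rewrite lef_pV2 ?posrE ?mulr_gt0 ?ltr0n ?fact_gt0 //.
by rewrite ler_peMr ?ler0n // ler1n.
Qed.

(** Domination by the exponential series at |t| gives absolute convergence for every [t]. *)
Lemma is_cvg_expq k t : cvgn (pseries (expq_coeff k) t).
Proof.
apply: normed_cvg; apply: (@series_le_cvg _ _ (exp_coeff `|t|)) => [n|n|n|].
- exact: normr_ge0.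
- by rewrite /exp_coeff /= divr_ge0 // exprn_ge0.
- rewrite /exp_coeff /= normrM normrX ger0_norm ?expq_coeff_ge0 // mulrC.
  by rewrite ler_wpM2l ?exprn_ge0 // expq_coeff_le.
- exact: is_cvg_series_exp_coeff.
Qed.

(** The factor n + 1 of termwise differentiation cancels in (n + 1)!, leaving n! (n + k + 2) in the
    denominator. *)
Lemma pseries_diffs_expq k : pseries_diffs (expq_coeff k) = expq_coeff k.+1.
Proof.
apply/funext => n; rewrite /pseries_diffs /expq_coeff factS natrM !invfM.
by rewrite addSnnS -mulrA mulVKf ?pnatr_eq0.
Qed.

Lemma is_derive_expq k (t : R) : is_derive t 1 (expq k) (expq k.+1 t).
Proof.
rewrite /expq -(pseries_diffs_expq k).
(* Any radius beyond |t| would do here. *)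
apply: (@pseries_snd_diffs _ _ (`|t| + 1)); rewrite ?pseries_diffs_expq;
  try exact: is_cvg_expq.
by rewrite [ltRHS]ger0_norm ?addr_ge0 // ltrDl.
Qed.

(** Since n! (n + 1) = (n + 1)!, multiplication by [t] shifts the series of [expq 0] to the
    exponential series without its constant term. *)
Lemma mul_expq0 t : t * expq 0 t = expR t - 1.
Proof.
suff : t * expq 0 t + 1 = expR t by move=> <-; rewrite addrK.
have e : (fun n => series (exp_coeff t) n.+1) @ \oo --> expR t.
  by rewrite (cvg_shiftS (series (exp_coeff t))); exact: is_cvg_series_exp_coeff.
apply: (cvg_unique _ _ e) => //.
rewrite (_ : (fun n => _) = (fun n => t * pseries (expq_coeff 0) t n + 1)).
  by apply: cvgD; [apply: cvgMr; exact: is_cvg_expq|exact: cvg_cst].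
apply/funext => n; rewrite /series /= big_nat_recl //= addrC; congr (_ + _).
  rewrite mulr_sumr; apply: eq_bigr => i _.
  rewrite /exp_coeff /expq_coeff /= addn0 factS natrM exprS -mulrA.
  by rewrite [X in _ * X]mulrC [(i.+1%:R * _)%R]mulrC.
by rewrite /exp_coeff /= fact0 divr1.
Qed.

Lemma expq0_at0 : expq 0 0 = 1.
Proof.
(* The shift skips the empty partial sum; all later ones equal 1. *)
apply: cvg_lim => //; rewrite -cvg_shiftS.
rewrite (_ : (fun n => _) = cst 1); first exact: cvg_cst.
apply/funext => n; rewrite /pseries /series /= big_nat_recl // big1 => [|i _].
  by rewrite addr0 expr0 /expq_coeff fact0 !mulr1 invr1.
by rewrite expr0n mulr0.
Qed.

(** The induction on [k] keeps [j] general, since the derivative of [F j \o f] is that of [f] times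
    [F j.+1 \o f]. *)
Lemma Ck_comp_derivatives n k (U : set 'rV[R]_n) (F : nat -> R -> R) f :
  open U -> (forall j (t : R), is_derive t 1 (F j) (F j.+1 t)) ->
  Ck k U f -> forall j, Ck k U (F j \o f).
Proof.
move=> oU dF; have dFj j t : differentiable (F j) t.
  by apply/derivable1_diffP; exact: ex_derive.
elim: k => [|k IH] Cf j.
  move=> x Ux; apply: continuous_comp; first exact: Cf.
  exact: differentiable_continuous.
case: (Cf) => [df Df]; split=> [x Ux|v].
  by apply: differentiable_comp; [exact: df|exact: dFj].
apply: Ck_ext (CkM oU (Df v) (IH (CkS Cf) j.+1)) => // x Ux /=.
rewrite [RHS](@deriveE _ _ _ (F j \o f)); last first.
  by apply: differentiable_comp; [exact: df|exact: dFj].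
rewrite diff_comp /=; [|exact: df|exact: dFj].
rewrite -(deriveE v (df _ Ux)).
have -> : 'd (F j) (f x) ('D_v f x) = 'D_v f x *: 'd (F j) (f x) 1.
  by rewrite -linearZ /= /GRing.scale /= mulr1.
by rewrite -[F j.+1 _](@derive_val _ _ _ _ _ _ _ (dF j (f x))) -deriveE.
Qed.

End ExpQuotient.

(** * The derivative of a logarithm *)

Section LogDerivative.
Context {R : realType} {n : nat} {M : manifold R n}.
Context (f : smooth_fun M) (f_gt0 : forall p, 0 < f p).

(* Tangent vectors are abstract derivations, so the chain rule is not at hand. With
   w = ln f - ln (f p), which vanishes at p, f = f p * (1 + w * expq 0 w), and the
   product rule at p suffices. *)
Lemma vact_ln (X : vfield M) p : vact X (smooth_ln f_gt0) p = vact X f p / f p.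
Proof.
pose u := smooth_ln f_gt0; pose w := u - smooth_cst (u p).
have qS : is_smooth (fun q => expq 0 (w q)).
  move=> a Aa k; apply: (Ck_comp_derivatives (ccod_open a)) => [j t|].
    exact: is_derive_expq.
  exact: (smooth_funE w).
pose Q := mk_smooth qS.
have fp0 : f p != 0 by rewrite gt_eqF.
have fE : f = smooth_cst (f p) * (1 + w * Q).
  apply: smooth_fun_ext => q; rewrite !smoothM smoothD smoothM smooth1 smooth_cstE.
  rewrite [Q q]/= mul_expq0 addrC subrK !smoothE.
  by rewrite expRD expRN !lnK ?posrE // mulrCA divff // mulr1.
have wp : w p = 0 by rewrite !smoothE subrr.
have Qp : Q p = 1 by exact: etrans (congr1 (expq 0) wp) expq0_at0.
have := congr1 (fun s => vact X s p) fE.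
rewrite !vactE !smoothD !smoothM !smoothD !smoothM smooth_cstE Qp wp !smoothE => ->.
by rewrite -/u; field.
Qed.

End LogDerivative.

(** * Tangent vectors of the product *)

Section WarpedProduct.
Context {R : realType} {n1 n2 : nat} (M1 : manifold R n1) (M2 : manifold R n2).
Context (g1 : metric M1) (g2 : metric M2) (c : R).
Context (f1 : smooth_fun M1) (f2 : smooth_fun M2).
Context (f1_gt0 : forall p, 0 < f1 p).
Local Notation MN := (prod_manifold M1 M2).
Context (h : metric MN).
Context (hE : forall x (u v : tangent x), h x u v = h_form c f1 f2 g1 g2 u v).

(** The formula for [h] sees only the two projections of [u - v], also in its last term, so h(u - v,
    u - v) = 0 and positivity applies. This stands in for the splitting of the tangent space of a
    product. *)
Lemma tangent_prod_eq (x : MN) (u v : tangent x) :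
  dpi1 u = dpi1 v -> dpi2 u = dpi2 v -> u = v.
Proof.
move=> uv1 uv2; apply/eqP; rewrite -subr_eq0; apply/eqP.
have w1 : dpi1 (u - v) = 0.
  apply: tangent_ext => f; have E : u (hfun M2 f) = v (hfun M2 f).
    exact: (congr1 (fun w => tangent_val w f) uv1).
  by rewrite -[LHS]/(u (hfun M2 f) - v (hfun M2 f)) E subrr.
have w2 : dpi2 (u - v) = 0.
  apply: tangent_ext => f; have E : u (vfun M1 f) = v (vfun M1 f).
    exact: (congr1 (fun w => tangent_val w f) uv2).
  by rewrite -[LHS]/(u (vfun M1 f) - v (vfun M1 f)) E subrr.
have wf : (u - v) (hfun M2 f1) = 0.
  by have := congr1 (fun w => tangent_val w f1) w1.
have g0 m (M : manifold R m) (g : metric M) p : g p 0 0 = 0.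
  exact: (congr1 (fun s : smooth_fun M => s p) (inner0l g 0)).
apply: (@metric_eq0 _ _ _ h).
by rewrite hE /h_form /odot /differential w1 w2 wf !g0 !(mulr0, addr0).
Qed.

(** * Algebra and brackets of lifts *)

Context (hl : vfield M1 -> vfield MN) (vl : vfield M2 -> vfield MN).
Context (hlP : horizontal_lift hl) (vlP : vertical_lift vl).
Implicit Types (X Y Z : vfield M1) (U V W : vfield M2).

Lemma hfunE f (x : MN) : hfun M2 f x = f x.1. Proof. by []. Qed.
Lemma vfunE f (x : MN) : vfun M1 f x = f x.2. Proof. by []. Qed.

Lemma hl_hfun X f : vact (hl X) (hfun M2 f) = hfun M2 (vact X f).
Proof.
apply: smooth_fun_ext => x.
by have := congr1 (fun w => tangent_val w f) (hlP X x).1.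
Qed.

Lemma hl_vfun X f : vact (hl X) (vfun M1 f) = 0.
Proof.
apply: smooth_fun_ext => x.
by have := congr1 (fun w => tangent_val w f) (hlP X x).2.
Qed.

Lemma vl_hfun U f : vact (vl U) (hfun M2 f) = 0.
Proof.
apply: smooth_fun_ext => x.
by have := congr1 (fun w => tangent_val w f) (vlP U x).1.
Qed.

Lemma vl_vfun U f : vact (vl U) (vfun M1 f) = vfun M1 (vact U f).
Proof.
apply: smooth_fun_ext => x.
by have := congr1 (fun w => tangent_val w f) (vlP U x).2.
Qed.

Lemma vfield_prod_eq (A B : vfield MN) :
  (forall f, vact A (hfun M2 f) = vact B (hfun M2 f)) ->
  (forall f, vact A (vfun M1 f) = vact B (vfun M1 f)) -> A = B.
Proof.
move=> AB1 AB2; apply: vfield_ext => x.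
apply: tangent_prod_eq; apply: tangent_ext => f.
  exact: (congr1 (fun s : smooth_fun MN => s x) (AB1 f)).
exact: (congr1 (fun s : smooth_fun MN => s x) (AB2 f)).
Qed.

(** The lifts are given only through their projections; this and the following rules hold because
    the projections determine a field. *)
Lemma hlD X Y : hl (X + Y) = hl X + hl Y.
Proof.
apply: vfield_prod_eq => f; rewrite vact_addl ?hl_hfun ?hl_vfun ?addr0 //.
exact: smooth_fun_ext.
Qed.

Lemma vlD U V : vl (U + V) = vl U + vl V.
Proof.
apply: vfield_prod_eq => f; rewrite vact_addl ?vl_hfun ?vl_vfun ?addr0 //.
exact: smooth_fun_ext.
Qed.

Lemma hlZ f X : hl (f *: X) = hfun M2 f *: hl X.
Proof.
apply: vfield_prod_eq => s; rewrite vact_scalel ?hl_hfun ?hl_vfun ?mulr0 //.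
exact: smooth_fun_ext.
Qed.

Lemma vlZ f U : vl (f *: U) = vfun M1 f *: vl U.
Proof.
apply: vfield_prod_eq => s; rewrite vact_scalel ?vl_hfun ?vl_vfun ?mulr0 //.
exact: smooth_fun_ext.
Qed.

Lemma hlN X : hl (- X) = - hl X.
Proof.
rewrite -scaleN1r hlZ -[RHS]scaleN1r; congr (_ *: _); exact: smooth_fun_ext.
Qed.

Lemma vlN U : vl (- U) = - vl U.
Proof.
rewrite -scaleN1r vlZ -[RHS]scaleN1r; congr (_ *: _); exact: smooth_fun_ext.
Qed.

Lemma hl0 : hl 0 = 0. Proof. by rewrite -(subrr 0) hlD hlN subrr. Qed.
Lemma vl0 : vl 0 = 0. Proof. by rewrite -(subrr 0) vlD vlN subrr. Qed.

Lemma lie_hh X Y : lie (hl X) (hl Y) = hl (lie X Y).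
Proof.
apply: vfield_prod_eq => f; rewrite vact_lie !(hl_hfun, hl_vfun).
  exact: smooth_fun_ext.
by rewrite !vact0 subrr.
Qed.

Lemma lie_vv U V : lie (vl U) (vl V) = vl (lie U V).
Proof.
apply: vfield_prod_eq => f; rewrite vact_lie !(vl_hfun, vl_vfun).
  by rewrite !vact0 subrr.
exact: smooth_fun_ext.
Qed.

Lemma lie_hv X U : lie (hl X) (vl U) = 0.
Proof.
apply: vfield_prod_eq => f; rewrite vact_lie !(vl_hfun, vl_vfun, hl_hfun, hl_vfun);
  by rewrite vact0 subr0; apply: smooth_fun_ext.
Qed.

Lemma lie_vh X U : lie (vl U) (hl X) = 0.
Proof.
apply: vfield_prod_eq => f; rewrite vact_lie !(vl_hfun, vl_vfun, hl_hfun, hl_vfun);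
  by rewrite vact0 subr0; apply: smooth_fun_ext.
Qed.

(** * The metric on lifts *)

Local Notation phi := (hfun M2 f1).
Local Notation psi := (vfun M1 f2).
Local Notation K := (@smooth_cst _ _ MN (c ^+ 2)).

Lemma inner_hh X Y : inner h (hl X) (hl Y) = hfun M2 (inner g1 X Y)
  + K * psi * psi * hfun M2 (vact X f1) * hfun M2 (vact Y f1).
Proof.
apply: smooth_fun_ext => x; rewrite [LHS]hE /h_form /odot /differential.
have [-> ->] := hlP X x; have [-> ->] := hlP Y x.
have E Z : hl Z x phi = hfun M2 (vact Z f1) x by rewrite -hl_hfun.
have g0 : g2 x.2 0 0 = 0.
  exact: (congr1 (fun s : smooth_fun M2 => s x.2) (inner0l g2 0)).
by rewrite !E g0 !smoothE [hfun M2 (inner _ _ _) x]/=; field.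
Qed.

Lemma inner_vv U V : inner h (vl U) (vl V) = phi * phi * vfun M1 (inner g2 U V).
Proof.
apply: smooth_fun_ext => x; rewrite [LHS]hE /h_form /odot /differential.
have [-> ->] := vlP U x; have [-> ->] := vlP V x.
have E W : vl W x phi = 0.
  exact: (congr1 (fun s : smooth_fun MN => s x) (vl_hfun W f1)).
have g0 : g1 x.1 0 0 = 0.
  exact: (congr1 (fun s : smooth_fun M1 => s x.1) (inner0l g1 0)).
by rewrite !E g0 !smoothE [vfun M1 (inner _ _ _) x]/=; field.
Qed.

Lemma inner_hv X U : inner h (hl X) (vl U) = 0.
Proof.
apply: smooth_fun_ext => x; rewrite [LHS]hE /h_form /odot /differential.
have [-> ->] := hlP X x; have [-> ->] := vlP U x.
have E W : vl W x phi = 0.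
  exact: (congr1 (fun s : smooth_fun MN => s x) (vl_hfun W f1)).
have g10 : g1 x.1 (X x.1) 0 = 0.
  have := congr1 (fun s : smooth_fun M1 => s x.1) (inner0l g1 X).
  by rewrite inner_sym.
have g20 : g2 x.2 0 (U x.2) = 0.
  exact: (congr1 (fun s : smooth_fun M2 => s x.2) (inner0l g2 U)).
by rewrite !E g10 g20 !(mulr0, addr0, mul0r).
Qed.

Lemma inner_vh X U : inner h (vl U) (hl X) = 0.
Proof. by rewrite inner_sym inner_hv. Qed.

(* This spares extending tangent vectors to vector fields by bump functions. *)
Lemma lift_slices (A : vfield MN) (x : MN) :
  A x = hl (vf_slice1 A x.2) x + vl (vf_slice2 A x.1) x.
Proof.
case: x => p q; set H := hl _ _; set V := vl _ _.
have [H1 H2] := hlP (vf_slice1 A q) (p, q).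
have [V1 V2] := vlP (vf_slice2 A p) (p, q).
apply: tangent_prod_eq; apply: tangent_ext => f.
  have EH : H (hfun M2 f) = A (p, q) (hfun M2 f).
    exact: (congr1 (fun w => tangent_val w f) H1).
  have EV : V (hfun M2 f) = 0 by exact: (congr1 (fun w => tangent_val w f) V1).
  by rewrite -[RHS]/(H (hfun M2 f) + V (hfun M2 f)) EH EV addr0.
have EH : H (vfun M1 f) = 0 by exact: (congr1 (fun w => tangent_val w f) H2).
have EV : V (vfun M1 f) = A (p, q) (vfun M1 f).
  exact: (congr1 (fun w => tangent_val w f) V2).
by rewrite -[RHS]/(H (vfun M1 f) + V (vfun M1 f)) EH EV add0r.
Qed.

(** At [x] the second entry of h(C, C), where C = A - B, may be replaced by the sum of lifts from
    [lift_slices]; hence h(C, C) = 0 at [x]. *)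
Lemma lift_test (A B : vfield MN) :
  (forall Z, inner h A (hl Z) = inner h B (hl Z)) ->
  (forall W, inner h A (vl W) = inner h B (vl W)) -> A = B.
Proof.
move=> AH AV; apply/eqP; rewrite -subr_eq0; apply/eqP.
set C := A - B; apply: vfield_ext => x; apply: (@metric_eq0 _ _ _ h).
rewrite {2}(lift_slices C x).
have E : inner h C (hl (vf_slice1 C x.2) + vl (vf_slice2 C x.1)) = 0.
  by rewrite inner_addr !inner_addl !innerNl AH AV !subrr addr0.
exact: (congr1 (fun s : smooth_fun MN => s x) E).
Qed.

(** * The Levi-Civita connection on lifts *)

Context (D1 : connection M1) (D2 : connection M2) (D : connection MN).
Context (D1_LC : levi_civita g1 D1) (D2_LC : levi_civita g2 D2).
Context (D_LC : levi_civita h D).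
Context (G1 : vfield M1) (G2 : vfield M2).
Context (G1P : is_gradient g1 f1 G1) (G2P : is_gradient g2 f2 G2).
Context (G1_par : parallel D1 G1) (G2_par : parallel D2 G2).

Local Notation b := (hfun M2 (inner g1 G1 G1)).
Local Notation E := (1 + K * psi * psi * b).

Lemma phi_neq0 (x : MN) : phi x != 0.
Proof. by rewrite gt_eqF // f1_gt0. Qed.

Lemma E_neq0 (x : MN) : E x != 0.
Proof.
have b0 : 0 <= b x.
  (* [metric_pos] speaks of nonzero vectors, so a zero gradient is treated apart. *)
  rewrite hfunE /=; have [->|/eqP/(metric_pos g1)/ltW//] := eqVneq (G1 x.1) 0.
  by have := congr1 (fun s : smooth_fun M1 => s x.1) (inner0l g1 0) => /= ->.
rewrite !smoothE gt_eqF // ltr_wpDr // mulr_ge0 // -mulrA -expr2.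
by rewrite mulr_ge0 // sqr_ge0.
Qed.

(** Real-number forms, with b1 written as G1(f1), that discharge the side conditions left by
    [field]. *)
Lemma denominators_neq0 (x : MN) :
  f1 x.1 != 0 /\ 1 + c ^+ 2 * f2 x.2 * f2 x.2 * vact G1 f1 x.1 != 0.
Proof.
split; first exact: phi_neq0.
by have := E_neq0 x; rewrite !(smoothE, hfunE, vfunE) (inner_gradient _ G1P).
Qed.

(** Inverses are kept as smooth functions, since they occur in coefficients of vector fields and get
    differentiated. *)
Local Notation phii := (smooth_inv phi_neq0).
Local Notation Ei := (smooth_inv E_neq0).

Lemma vact_hl_b X : vact (hl X) b = 0.
Proof.
by rewrite hl_hfun (vact_norm_parallel D1_LC G1_par); exact: smooth_fun_ext.
Qed.

Definition lift_actE :=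
  (@vactE R _ MN, vact_hl_b, hl_hfun, hl_vfun, vl_hfun, vl_vfun).

Definition inner_liftE := (inner_hh, inner_vv, inner_hv, inner_vh).
Definition lie_liftE := (lie_hh, lie_vv, lie_hv, lie_vh).

Lemma nabla_hh X Y : D (hl X) (hl Y) = hl (D1 X Y)
  - (K * psi * hfun M2 (vact X f1) * hfun M2 (vact Y f1) * phii * phii) *: vl G2.
Proof.
apply: lift_test => Z; apply: smooth_fun_ext => x;
  have [p0 e0] := denominators_neq0 x;
  apply: (@mulfI _ (2 : R)) => //; rewrite (koszul D_LC) !lie_liftE;
  rewrite inner_addl innerNl inner_scalel !inner_liftE ?inner0l.
  rewrite !lift_actE (vact_nabla_parallel D1_LC G1P G1_par).
  rewrite !vact_lie !(smoothE, hfunE, vfunE).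
  (* The terms with c^2 reduce to 2 c^2 f2^2 X(Y(f1)) Z(f1); the rest is Koszul's formula on M1. *)
  have /esym/eqP := koszul D1_LC X Y Z x.1; rewrite -subr_eq0 => /eqP kz.
  by apply/eqP; rewrite -subr_eq0 -[X in _ == X]kz; apply/eqP; field.
rewrite !lift_actE (inner_gradient _ G2P) !(smoothE, hfunE, vfunE).
by field; rewrite ?p0 ?e0.
Qed.

(** Koszul's formula keeps only the derivative of h(X^h, Z^h) along U^v, and that of h(U^v, Z^v)
    along X^h. The factor 1 / E comes from h((grad f1)^h, Z^h) = E Z(f1). *)
Lemma nabla_hv X U : D (hl X) (vl U) =
  (K * psi * vfun M1 (vact U f2) * hfun M2 (vact X f1) * Ei) *: hl G1
  + (hfun M2 (vact X f1) * phii) *: vl U.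
Proof.
apply: lift_test => Z; apply: smooth_fun_ext => x;
  have [p0 e0] := denominators_neq0 x;
  apply: (@mulfI _ (2 : R)) => //; rewrite (koszul D_LC) !lie_liftE;
  rewrite inner_addl !inner_scalel !inner_liftE ?inner0l.
  rewrite !lift_actE !(smoothE, hfunE, vfunE) !(inner_gradient _ G1P).
  by field; rewrite ?p0 ?e0.
rewrite !lift_actE !(smoothE, hfunE, vfunE) ?(inner_gradient _ G1P).
by field; rewrite ?p0 ?e0.
Qed.

Lemma nabla_vh X U : D (vl U) (hl X) = D (hl X) (vl U).
Proof. by have [T _] := D_LC; apply/eqP; rewrite -subr_eq0 T lie_vh. Qed.

Lemma nabla_vv U V : D (vl U) (vl V) = vl (D2 U V)
  - (phi * vfun M1 (inner g2 U V) * Ei) *: hl G1.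
Proof.
apply: lift_test => W; apply: smooth_fun_ext => x;
  have [p0 e0] := denominators_neq0 x;
  apply: (@mulfI _ (2 : R)) => //; rewrite (koszul D_LC) !lie_liftE;
  rewrite inner_addl innerNl inner_scalel !inner_liftE ?inner0l.
  rewrite !lift_actE !(smoothE, hfunE, vfunE) !(inner_gradient _ G1P).
  by field; rewrite ?p0 ?e0.
rewrite !lift_actE !(smoothE, hfunE, vfunE) ?(inner_gradient _ G1P).
(* As f1^h is constant along vertical lifts, this is f1^2 times Koszul's formula on M2. *)
transitivity (f1 x.1 ^+ 2 * (2 * inner g2 (D2 U V) W x.2)).
  by rewrite (koszul D2_LC); ring.
by field; rewrite ?p0 ?e0.
Qed.

Definition nabla_liftE := (@nablaD _ _ MN D, @nablaN _ _ MN D,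
  @nabla_leibniz _ _ MN D, nabla_vh, nabla_hh, nabla_hv, nabla_vv).

(** * The curvature on lifts *)

Local Notation Ex x := (1 + c ^+ 2 * f2 x.2 * f2 x.2 * vact G1 f1 x.1).

(** Testing on [F] at [x] makes this an identity of real fractions, as in the lemmas below. The
    vertical parts cancel because X(Y(f1)) = (D1 X Y)(f1). *)
Lemma curvature_hhh X Y Z (x : MN) F :
  vact (curvature D (hl X) (hl Y) (hl Z)) F x =
  vact (hl (curvature D1 X Y Z)) F x.
Proof.
have [p0 e0] := denominators_neq0 x.
rewrite /curvature lie_hh !nabla_liftE !(hlD, hlN) !vact_linearl.
rewrite !lift_actE !(vact_nabla_parallel D1_LC G1P G1_par) vact_lie.
rewrite !smoothE !hfunE !vfunE ?smoothE ?(inner_gradient _ G1P).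
by field; rewrite ?p0 ?e0.
Qed.

(** Terms symmetric in [X] and [Y] drop out; the rest has the factor X(Y(f1)) - Y(X(f1)) and is
    cancelled by the bracket term. *)
Lemma curvature_hhv X Y U (x : MN) F :
  vact (curvature D (hl X) (hl Y) (vl U)) F x = 0.
Proof.
have [p0 e0] := denominators_neq0 x.
rewrite /curvature lie_hh !nabla_liftE !G1_par !hl0 !vact_linearl.
rewrite !lift_actE vact_lie.
rewrite !smoothE !hfunE !vfunE ?smoothE ?(inner_gradient _ G1P).
by field; rewrite ?p0 ?e0.
Qed.

(** The wedge stems from the summand (b1 / f1) U^v of the derivative of (grad f1)^h along U^v. *)
Lemma curvature_vvh U V Z (x : MN) F :
  vact (curvature D (vl U) (vl V) (hl Z)) F x =
  c ^+ 2 * f2 x.2 * vact G1 f1 x.1 * vact Z f1 x.1 / (f1 x.1 * Ex x)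
  * vact (vl (wedge g2 U V G2)) F x.
Proof.
have [p0 e0] := denominators_neq0 x.
rewrite /curvature lie_vv /wedge !nabla_liftE !vact_linearl.
rewrite !lift_actE vact_lie -(D2_LC.1 U V) !(vlD, vlN, vlZ) !vact_linearl.
rewrite !(inner_sym g2 _ G2) !(inner_gradient _ G2P) (inner_sym g2 V U).
rewrite !smoothE !hfunE !vfunE ?smoothE ?(inner_gradient _ G1P).
by field; rewrite ?p0 ?e0.
Qed.

(** Both corrections come from differentiating (grad f1)^h and its coefficient: the derivative of 1
    / E contributes twice what the derivative of (grad f1)^h takes away once. *)
Lemma curvature_vvv U V W (x : MN) F :
  vact (curvature D (vl U) (vl V) (vl W)) F x =
  vact (vl (curvature D2 U V W)) F x
  - vact G1 f1 x.1 / Ex x * vact (vl (wedge g2 U V W)) F x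
  + c ^+ 2 * f1 x.1 * f2 x.2 * vact G1 f1 x.1 / Ex x ^+ 2
    * vact (wedge g2 U V W) f2 x.2 * vact (hl G1) F x.
Proof.
have [p0 e0] := denominators_neq0 x; have [T C] := D2_LC.
rewrite /curvature lie_vv /wedge -T !nabla_liftE.
rewrite !(vlD, vlN, vlZ) !vact_linearl !inner_addl !innerNl.
rewrite !lift_actE !C.
rewrite !smoothE !hfunE !vfunE ?smoothE ?(inner_gradient _ G1P).
by field; rewrite ?p0 ?e0.
Qed.

(** The bracket vanishes, and the two orders of differentiation combine along grad f2 to 1 - (c
    f2)^2 b1 / E = 1 / E. *)
Lemma curvature_hvh X U Z (x : MN) F :
  vact (curvature D (hl X) (vl U) (hl Z)) F x =
  c ^+ 2 * (vact X f1 x.1 / f1 x.1) * (vact Z f1 x.1 / f1 x.1) * vact U f2 x.2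
  / Ex x * vact (vl G2) F x.
Proof.
have [p0 e0] := denominators_neq0 x.
rewrite /curvature lie_hv nabla0l !nabla_liftE !G1_par !G2_par ?hl0 ?vl0.
rewrite !vact_linearl !lift_actE (vact_nabla_parallel D1_LC G1P G1_par).
rewrite (inner_sym g2 U G2) (inner_gradient _ G2P).
rewrite !smoothE !hfunE !vfunE ?smoothE ?(inner_gradient _ G1P).
by field; rewrite ?p0 ?e0.
Qed.

(** Second derivatives of f2 cancel because grad f2 is parallel; along grad f1 there remains 1 / E -
    (c f2)^2 b1 / E^2 = 1 / E^2. *)
Lemma curvature_hvv X U W (x : MN) F :
  vact (curvature D (hl X) (vl U) (vl W)) F x =
  c ^+ 2 * (vact X f1 x.1 / f1 x.1) / Ex x *
  (f2 x.2 * vact G1 f1 x.1 * vact (vl (wedge g2 G2 U W)) F x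
   - f1 x.1 * vact U f2 x.2 * vact W f2 x.2 / Ex x * vact (hl G1) F x).
Proof.
have [p0 e0] := denominators_neq0 x.
rewrite /curvature lie_hv nabla0l /wedge !nabla_liftE.
rewrite !(vlD, vlN, vlZ) !G1_par ?hl0 !vact_linearl !lift_actE.
rewrite (vact_nabla_parallel D2_LC G2P G2_par) (inner_gradient _ G2P).
rewrite !smoothE !hfunE !vfunE ?smoothE ?(inner_gradient _ G1P).
by field; rewrite ?p0 ?e0.
Qed.

End WarpedProduct.

Theorem proposition5 (R : realType) (n1 n2 : nat)
  (M1 : manifold R n1) (M2 : manifold R n2)
  (M1_connected : connected [set: M1]) (M2_connected : connected [set: M2])
  (g1 : metric M1) (g2 : metric M2)
  (c : R) (f1 : smooth_fun M1) (f2 : smooth_fun M2)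
  (f1_gt0 : forall p, 0 < f1 p) (f2_gt0 : forall q, 0 < f2 q)
  (f1_nonconstant : exists p p', f1 p <> f1 p')
  (D1 : connection M1) (D2 : connection M2)
  (D1_LC : levi_civita g1 D1) (D2_LC : levi_civita g2 D2)
  (gradf1 : vfield M1) (gradf2 : vfield M2)
  (gradf1P : is_gradient g1 f1 gradf1) (gradf2P : is_gradient g2 f2 gradf2)
  (gradf1_parallel : parallel D1 gradf1) (gradf2_parallel : parallel D2 gradf2)
  (h : metric (prod_manifold M1 M2))
  (hE : forall x (u v : tangent x), h x u v = h_form c f1 f2 g1 g2 u v)
  (D : connection (prod_manifold M1 M2)) (D_LC : levi_civita h D)
  (hl : vfield M1 -> vfield (prod_manifold M1 M2))
  (vl : vfield M2 -> vfield (prod_manifold M1 M2))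
  (hlP : horizontal_lift hl) (vlP : vertical_lift vl)
  (X1 Y1 Z1 : vfield M1) (X2 Y2 Z2 : vfield M2) :
  let b1 : smooth_fun M1 := inner g1 gradf1 gradf1 in
  let lnf1 : smooth_fun M1 := smooth_ln f1_gt0 in
  forall x : prod_manifold M1 M2,
  let E : R := 1 + (c * vfun M1 f2 x) ^+ 2 * hfun M2 b1 x in
  [/\ curvature D (hl X1) (hl Y1) (hl Z1) x = hl (curvature D1 X1 Y1 Z1) x,
      curvature D (vl X2) (vl Y2) (vl Z2) x =
        vl (curvature D2 X2 Y2 Z2) x
        - (hfun M2 b1 x / E) *: vl (wedge g2 X2 Y2 Z2) x
        + (c ^+ 2 * hfun M2 f1 x * vfun M1 f2 x * hfun M2 b1 x / E ^+ 2
           * vfun M1 (vact (wedge g2 X2 Y2 Z2) f2) x) *: hl gradf1 x,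
      curvature D (hl X1) (hl Y1) (vl Z2) x = 0,
      curvature D (vl X2) (vl Y2) (hl Z1) x =
        (c ^+ 2 * vfun M1 f2 x * hfun M2 b1 x * hfun M2 (vact Z1 f1) x
         / (hfun M2 f1 x * E)) *: vl (wedge g2 X2 Y2 gradf2) x
    & curvature D (hl X1) (vl Y2) (hl Z1) x =
        (c ^+ 2 * hfun M2 (vact X1 lnf1) x * hfun M2 (vact Z1 lnf1) x
         * vfun M1 (vact Y2 f2) x / E) *: vl gradf2 x
      /\
      curvature D (hl X1) (vl Y2) (vl Z2) x =
        (c ^+ 2 * hfun M2 (vact X1 lnf1) x / E) *:
          ((vfun M1 f2 x * hfun M2 b1 x) *: vl (wedge g2 gradf2 Y2 Z2) x
           - (hfun M2 f1 x * vfun M1 (vact Y2 f2) x * vfun M1 (vact Z2 f2) x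
              / E) *: hl gradf1 x)].

Proof.
move=> b1 lnf1 x E.
have b1E : hfun M2 b1 x = vact gradf1 f1 x.1.
  by rewrite hfunE /b1 (inner_gradient _ gradf1P).
have EE : E = 1 + c ^+ 2 * f2 x.2 * f2 x.2 * vact gradf1 f1 x.1.
  by rewrite /E b1E vfunE; ring.
have lnE X : hfun M2 (vact X lnf1) x = vact X f1 x.1 / f1 x.1.
  by rewrite hfunE vact_ln.
rewrite !b1E !lnE EE.
(* Evaluated on a test function [F], each component is one of the curvature lemmas up to
   conversion. *)
split; [| | | | split]; apply: tangent_ext => F.
- exact: (curvature_hhh f1_gt0 hE hlP vlP D1_LC D_LC gradf1P gradf2P
    gradf1_parallel).
- exact: (curvature_vvv f1_gt0 hE hlP vlP D2_LC D_LC gradf1P).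
- exact: (curvature_hhv f1_gt0 hE hlP vlP D1_LC D_LC gradf1P gradf2P
    gradf1_parallel).
- exact: (curvature_vvh f1_gt0 hE hlP vlP D2_LC D_LC gradf1P gradf2P).
- exact: (curvature_hvh f1_gt0 hE hlP vlP D1_LC D2_LC D_LC gradf1P gradf2P
    gradf1_parallel gradf2_parallel).
- exact: (curvature_hvv f1_gt0 hE hlP vlP D1_LC D2_LC D_LC gradf1P gradf2P
    gradf1_parallel gradf2_parallel).
Qed.
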